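(* Let $\Phi=(V,[q]^V,C)$ be an atomic $(k,\Delta)$-CSP formula and $\lambda>0$. Let $r_{\max}=\frac{\max\{1,\lambda\}}{q-1+\lambda}$ and $\zeta=\frac{2\ln(2-r_{\max})}{\ln(1/r_{\max})-\ln(2-r_{\max})}$, and suppose $(8e)^3\cdot\max\{1,1/\lambda\}\cdot r_{\max}^{k-1}\cdot(\Delta k+1)^{2+\zeta}\le1$. Let $\mu$ be the Gibbs distribution on the satisfying assignments $\Omega_\Phi$ given by $\mu(\sigma)\propto\lambda^{|\sigma^{-1}(1)|}$, let $\sigma\sim\mu$ and $\mathcal X=\sum_{v\in V}\mathbb I[\sigma_v=1]$. Then for every $\delta>0$, $$\Pr_\mu\big[|\mathcal X-\mathbb E_\mu[\mathcal X]|\ge\delta\,\mathbb E_\mu[\mathcal X]\big]\le\frac{4\Delta k(\Delta k+1)}{\delta^2\big(\frac{\lambda}{q-1+\lambda}(1-\frac{1}{\Delta k})\big)^2|V|}.$$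
   Context: A CSP formula $\Phi=(V,[q]^V,C)$ has variables $V$ with domain $[q]$ and constraints $C$, each constraint $c$ depending on $\mathsf{vbl}(c)\subseteq V$ and declaring each assignment of $\mathsf{vbl}(c)$ satisfying or violating. It is a $(k,\Delta)$-CSP formula if $|\mathsf{vbl}(c)|=k$ for all $c$ and each variable is in at most $\Delta$ constraints; atomic if each constraint has at most one violating assignment. $\sigma^{-1}(1)=\{v:\sigma_v=1\}$. *)

(* Defs.v *)
From HB Require Import structures.
From mathcomp Require Import all_boot all_order all_algebra.
From mathcomp Require Import all_classical all_reals all_analysis.

Set Implicit Arguments.
Unset Strict Implicit.
Unset Printing Implicit Defensive.

Import Order.TTheory GRing.Theory Num.Theory.
Local Open Scope ring_scope.

(* The domain [q] = {1, ..., q} is encoded by 'I_q, the ordinal i standing for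
   the value i + 1. *)
Definition assignment (q : nat) (V : finType) := {ffun V -> 'I_q}.

Definition local_assignment (q : nat) (V : finType) (A : {set V}) :=
  {ffun {v : V | v \in A} -> 'I_q}.

Definition restrict (q : nat) (V : finType) (A : {set V})
    (sigma : assignment q V) : local_assignment q A :=
  [ffun v => sigma (val v)].

(* The constraints are indexed by a finite type C. *)
Record csp_formula (q : nat) (V C : finType) := CspFormula {
  vbl : C -> {set V};
  violating : forall c : C, {set local_assignment q (vbl c)}
}.

Section Csp.
Variables (q : nat) (V C : finType) (Phi : csp_formula q V C).

Definition kDelta_csp (k Delta : nat) : Prop :=
  (forall c : C, #|vbl Phi c| = k) /\
  (forall v : V, (#|[set c : C | v \in vbl Phi c]| <= Delta)%N).

Definition atomic : Prop := forall c : C, (#|violating Phi c| <= 1)%N.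

Definition satisfying : {set assignment q V} :=
  [set sigma : assignment q V |
    [forall c, restrict (vbl Phi c) sigma \notin violating Phi c]].

End Csp.

(* sigma^-1(1): the value 1 is the ordinal of underlying natural number 0. *)
Definition ones (q : nat) (V : finType) (sigma : assignment q V) : {set V} :=
  [set v | (sigma v).+1 == 1%N].

Section Gibbs.
Variables (R : realType) (q : nat) (V C : finType).
Variables (Phi : csp_formula q V C) (lambda : R).

Definition partition_function : R :=
  \sum_(sigma in satisfying Phi) lambda ^+ #|ones sigma|.

(* If no assignment satisfies Phi, this is the zero function. *)
Definition gibbs (sigma : assignment q V) : R :=
  if sigma \in satisfying Phi
  then lambda ^+ #|ones sigma| / partition_function else 0.

End Gibbs.

Section FiniteProbability.
Variables (R : realType) (T : finType) (mu : T -> R).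

Definition Pr (A : pred T) : R := \sum_(x | A x) mu x.

Definition Ex (f : T -> R) : R := \sum_x mu x * f x.

End FiniteProbability.

Definition num_ones (R : realType) (q : nat) (V : finType)
    (sigma : assignment q V) : R :=
  \sum_(v : V) (v \in ones sigma)%:R.

Definition r_max (R : realType) (q : nat) (lambda : R) : R :=
  Num.max 1 lambda / (q%:R - 1 + lambda).

Definition zeta (R : realType) (q : nat) (lambda : R) : R :=
  let r := r_max q lambda in
  2 * ln (2 - r) / (ln (1 / r) - ln (2 - r)).

(* Main.v *)
(* Chebyshev's inequality reduces the claim to a lower bound on the mean and an
   upper bound on the variance of X.  With the weights x = 2 r^k, the local lemma
   compares the Gibbs measure with the product measure in which every variable
   is independent, up to a factor (1 - x)^-m for an event meeting m constraints;
   applied to a single variable this bounds the mean.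

   For the variance take two independent Gibbs samples s, t.  Call a constraint
   bad if each of its variables takes the forbidden value in s or in t, and let
   K(u) be the connected component of u in the hypergraph of bad constraints.
   Exchanging s and t on K(u) preserves the law of the pair, and it changes the
   sign of [s_u = 1] - [t_u = 1] but not that of [s_v = 1] - [t_v = 1] for v
   outside K(u).  Hence 2 Cov(u, v) <= Pr(v in K(u)), and it remains to bound the
   mean size of K(u).  Under the product measure a constraint is bad with
   probability at most (r (2 - r))^k, and the exponent zeta is what makes this at
   most (Delta k + 1)^-2, so that the exploration of K(u), two constraints at a
   time, is subcritical. *)
Require Import Defs.
From HB Require Import structures.
From mathcomp Require Import all_boot all_order all_algebra.
From mathcomp Require Import all_classical all_reals all_analysis.
From mathcomp Require Import ring lra.

Set Implicit Arguments.
Unset Strict Implicit.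
Unset Printing Implicit Defensive.

Import Order.TTheory GRing.Theory Num.Theory.
Local Open Scope ring_scope.

Section ProductMeasure.
Import mathcomp.boot.fintype mathcomp.boot.finset.
Variables (R : realFieldType) (Q V : finType) (p : Q -> R).
Hypothesis p_ge0 : forall a, 0 <= p a.
Hypothesis p_sum1 : \sum_a p a = 1.
Local Notation config := {ffun V -> Q}.
Implicit Types (A B : {set V}) (s t : config).

Definition weight s : R := \prod_v p (s v).

Definition expect (f : config -> R) : R := \sum_s weight s * f s.

Definition glue A s t : config := [ffun v => if v \in A then t v else s v].

Definition depends_on A (T : Type) (f : config -> T) :=
  forall s t, {in A, s =1 t} -> f s = f t.

Lemma weight_ge0 s : 0 <= weight s.
Proof. by apply: prodr_ge0 => v _; exact: p_ge0. Qed.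

Lemma weight_glue A s t :
  weight (glue A s t) * weight (glue A t s) = weight s * weight t.
Proof.
rewrite /weight -!big_split; apply: eq_bigr => v _ /=.
by rewrite !ffunE; case: (v \in A); rewrite // mulrC.
Qed.

Lemma glueK A s t : glue A (glue A s t) (glue A t s) = s.
Proof. by apply/ffunP => v; rewrite !ffunE; case: (v \in A). Qed.

Lemma expect_swap (A : config -> config -> {set V}) (F : config -> config -> R) :
  (forall s t, A (glue (A s t) s t) (glue (A s t) t s) = A s t) ->
  \sum_s \sum_t weight s * weight t * F s t =
  \sum_(s : config) \sum_(t : config) weight s * weight t *
    F (glue (A s t) s t) (glue (A s t) t s).
Proof.
move=> invA; rewrite !pair_bigA /=.
pose h (st : config * config) :=
  (glue (A st.1 st.2) st.1 st.2, glue (A st.1 st.2) st.2 st.1).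
have hK : involutive h by case=> s t; rewrite /h /= invA !glueK.
rewrite (reindex h) /=; last by exists h => x _; exact: hK.
by apply: eq_bigr => -[s t] _ /=; rewrite weight_glue.
Qed.

Lemma weight_sum1 : \sum_s weight s = 1.
Proof.
rewrite /weight -(bigA_distr_bigA (fun _ : V => p)) /=.
by rewrite big1 // => v _; rewrite p_sum1.
Qed.

Lemma expect_ge0 f : (forall s, 0 <= f s) -> 0 <= expect f.
Proof. by move=> f0; apply: sumr_ge0 => s _; rewrite mulr_ge0 ?weight_ge0. Qed.

Lemma ler_expect f g : (forall s, f s <= g s) -> expect f <= expect g.
Proof.
by move=> fg; apply: ler_sum => s _; rewrite ler_wpM2l ?weight_ge0.
Qed.

Lemma expectM A f g : depends_on A f -> depends_on (~: A) g ->
  expect (fun s => f s * g s) = expect f * expect g.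
Proof.
move=> fA gA.
have -> : expect (fun s => f s * g s) =
    \sum_s \sum_t weight s * weight t * (f s * g s).
  apply: eq_bigr => s _; rewrite -mulr_suml -mulr_sumr weight_sum1 mulr1 //.
rewrite (@expect_swap (fun _ _ => A)) // /expect mulrC big_distrlr /=.
apply: eq_bigr => s _; apply: eq_bigr => t _.
rewrite (fA (glue A s t) t) => [|v vA]; last by rewrite ffunE vA.
rewrite (gA (glue A s t) s) => [|v]; first by rewrite (mulrC (f t)) mulrACA.
by rewrite inE ffunE => /negbTE->.
Qed.

Lemma expect_pin (r : R) A (b : V -> Q) : (forall a, p a <= r) ->
  expect (fun s => [forall v in A, s v == b v]%:R) <= r ^+ #|A|.
Proof.
move=> pr; rewrite /expect.
have -> : \sum_(s : config) weight s * [forall v in A, s v == b v]%:R =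
   \sum_(s : config) \prod_v (p (s v) * ((v \in A) ==> (s v == b v))%:R).
  apply: eq_bigr => s _; rewrite big_split /=; congr (_ * _).
  have [/forallP H|/forallPn[v /negbTE Hv]] := boolP [forall v in A, s v == b v].
    by rewrite big1 // => v _; rewrite H.
  by rewrite (bigD1 v) //= Hv mul0r.
rewrite -(bigA_distr_bigA (fun v a => p a * ((v \in A) ==> (a == b v))%:R)) /=.
rewrite (bigID (mem A)) /= [X in _ * X]big1 ?mulr1; last first.
  move=> v /negbTE vA; rewrite -[RHS]p_sum1; apply: eq_bigr => a _.
  by rewrite vA mulr1.
rewrite -prodr_const; apply: ler_prod => v vA; rewrite vA /=.
rewrite sumr_ge0 /= => [|a _]; last by rewrite mulr_ge0.
rewrite (bigD1 (b v)) //= eqxx mulr1 big1 ?addr0 // => a /negbTE->.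
by rewrite mulr0.
Qed.

Lemma expect_pin2 (r : R) A (b : V -> Q) :
  (forall a, p a <= r) -> r <= 1 ->
  \sum_(s : config) \sum_(t : config) weight s * weight t *
    [forall v in A, (b v == s v) || (b v == t v)]%:R <= (r * (2 - r)) ^+ #|A|.
Proof.
move=> pr r1; rewrite pair_bigA /=.
pose F v (ab : Q * Q) : R := p ab.1 * p ab.2 *
  ((v \in A) ==> ((b v == ab.1) || (b v == ab.2)))%:R.
have -> : \sum_(st : config * config) weight st.1 * weight st.2 *
     [forall v in A, (b v == st.1 v) || (b v == st.2 v)]%:R =
   \sum_(f : {ffun V -> Q * Q}) \prod_v F v (f v).
  rewrite (reindex (fun f : {ffun V -> Q * Q} =>
      ([ffun v => (f v).1], [ffun v => (f v).2]))) /=.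
    apply: eq_bigr => f _; rewrite /F !big_split /=; congr (_ * _ * _).
    - by apply: eq_bigr => v _; rewrite ffunE.
    - by apply: eq_bigr => v _; rewrite ffunE.
    case: (boolP [forall v in A, _ || _]) => [/forallP H|/forallPn[v]].
      by rewrite big1 // => v _; have := H v; rewrite !ffunE => ->.
    by rewrite !ffunE => /negbTE Hv; rewrite (bigD1 v) //= Hv mul0r.
  exists (fun st : config * config => [ffun v => (st.1 v, st.2 v)]).
    by move=> f _; apply/ffunP => v; rewrite !ffunE /=; case: (f v).
  by move=> [s t] _ /=; congr pair; apply/ffunP => v; rewrite !ffunE.
have sum2 : \sum_(ab : Q * Q) p ab.1 * p ab.2 = 1.
  by rewrite -(pair_bigA _ (fun a c => p a * p c)) -big_distrlr /= p_sum1 mulr1.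
rewrite -(bigA_distr_bigA F) /= (bigID (mem A)) /= [X in _ * X]big1 ?mulr1;
    last first.
  move=> v /negbTE vA; rewrite -[RHS]sum2; apply: eq_bigr => a _.
  by rewrite /F vA mulr1.
rewrite -prodr_const; apply: ler_prod => v vA.
have F0 a : 0 <= F v a by rewrite /F !mulr_ge0.
rewrite sumr_ge0 //=.
have -> : \sum_a F v a = 1 - (1 - p (b v)) * (1 - p (b v)).
  have -> : 1 - p (b v) = \sum_(a | a != b v) p a.
    by rewrite -p_sum1 (bigD1 (b v)) //= addrC addrK.
  rewrite big_distrlr /= pair_big /= -{1}sum2.
  rewrite [X in _ = X - _](bigID (fun ab : Q * Q => (ab.1 != b v) && (ab.2 != b v))) /=.
  rewrite [RHS]addrC addKr.
  rewrite [LHS](bigID (fun ab : Q * Q => (ab.1 != b v) && (ab.2 != b v))) /=.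
  rewrite [X in X + _]big1 ?add0r.
    apply: eq_bigr => ab; rewrite negb_and !negbK /F vA /= ![b v == _]eq_sym => ->.
    by rewrite mulr1.
  move=> ab /andP[/negbTE h1 /negbTE h2].
  by rewrite /F vA /= ![b v == _]eq_sym h1 h2 mulr0.
have := pr (b v); have := p_ge0 (b v); nra.
Qed.

End ProductMeasure.

Section LocalLemma.
Import mathcomp.boot.fintype mathcomp.boot.finset.
Variables (R : realFieldType) (Q V C : finType) (p : Q -> R).
Hypothesis p_ge0 : forall a, 0 <= p a.
Hypothesis p_sum1 : \sum_a p a = 1.
Variables (vb : C -> {set V}) (act : pred C) (bet : C -> V -> Q).
Local Notation config := {ffun V -> Q}.
Implicit Types (A : {set V}) (s t : config) (S T U : {set C}).

Definition viol c s := act c && [forall v in vb c, s v == bet c v].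

Definition sat S s := [forall c in S, ~~ viol c s].

Definition touch A := [set c | ~~ [disjoint vb c & A]].

Definition satw S : R := expect p (fun s => (sat S s)%:R).

Lemma viol_dep c : depends_on (vb c) (viol c).
Proof.
move=> s t st; congr (_ && _); apply: eq_forallb => v.
by case: (boolP (v \in vb c)) => // vc; rewrite st.
Qed.

Lemma sat_dep A S : depends_on (~: A) (sat (S :\: touch A)).
Proof.
move=> s t st; apply: eq_forallb => c; rewrite !inE negbK.
case: (boolP [disjoint _ & _]) => //= dcA; congr (_ ==> ~~ _).
apply: viol_dep => v vc; apply: st.
by rewrite inE (disjointFr dcA vc).
Qed.

Lemma satU1 c S s : sat (c |: S) s = ~~ viol c s && sat S s.
Proof.
apply/forall_inP/andP => [H|[cs /forall_inP H] d].
  split; first by apply: H; rewrite setU11.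
  by apply/forall_inP => d dS; apply: H; rewrite setU1r.
by rewrite !inE => /predU1P[->//|]; exact: H.
Qed.

Lemma sat_sub S T s : S \subset T -> sat T s -> sat S s.
Proof.
move=> /subsetP ST /forall_inP H; apply/forall_inP => c cS.
by apply: H; exact: ST.
Qed.

Lemma satw_ge0 S : 0 <= satw S.
Proof. by apply: expect_ge0. Qed.

Lemma satw0 : satw set0 = 1.
Proof.
rewrite -[RHS](weight_sum1 V p_sum1); apply: eq_bigr => s _.
have -> : sat set0 s by apply/forall_inP => c; rewrite inE.
by rewrite mulr1.
Qed.

Lemma expect_satD A (f : config -> R) S :
  (forall s, 0 <= f s) -> depends_on A f ->
  expect p (fun s => f s * (sat S s)%:R) <= expect p f * satw (S :\: touch A).
Proof.
move=> f0 fA; rewrite -(expectM p_sum1 (A := A)) //; last first.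
  by move=> s t st; rewrite (sat_dep S st).
apply: ler_expect => // s; rewrite ler_wpM2l // ler_nat.
by case: (boolP (sat S s)) => // /(sat_sub (subsetDl S (touch A)))->.
Qed.

Variables (N : nat) (pi x : R).
Hypothesis touch_le : forall c, (#|touch (vb c)| <= N)%N.
Hypothesis viol_le : forall c, expect p (fun s => (viol c s)%:R) <= pi.
Hypothesis x_ge0 : 0 <= x.
Hypothesis x_lt1 : x < 1.
Hypothesis pi_le : pi <= x * (1 - x) ^+ N.

Let y_gt0 : 0 < 1 - x. Proof. by rewrite subr_gt0. Qed.
Let y_le1 : 1 - x <= 1. Proof. by rewrite lerBlDr lerDl. Qed.

Lemma satw_setU n U T :
  (forall c S, c \notin S -> (#|S| < n)%N -> (1 - x) * satw S <= satw (c |: S)) ->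
  (#|U :|: T| <= n)%N -> (1 - x) ^+ #|U :\: T| * satw T <= satw (U :|: T).
Proof.
move=> step; elim: {U}_.+1 {-2}U (ltnSn #|U :\: T|) => // m IH U.
have [U0 _ _|[c]] := set_0Vmem (U :\: T).
  rewrite U0 cards0 mul1r; suff -> : U :|: T = T by [].
  by apply/setUidPr; rewrite -setD_eq0 U0.
rewrite inE => /andP[cT cU]; rewrite ltnS => Um Un.
have E : (U :\ c) :|: T = (U :|: T) :\ c.
  apply/setP => d; rewrite !inE; case: eqP => [->|//].
  by rewrite (negbTE cT).
have E' : (U :\ c) :\: T = (U :\: T) :\ c.
  by apply/setP => d; rewrite !inE; case: (d \in T); case: (d == c).
have cUT : c \in U :|: T by rewrite inE cU.
have cUDT : c \in U :\: T by rewrite inE cT.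
have Uc : #|U :\: T| = #|(U :\ c) :\: T|.+1 by rewrite E' (cardsD1 c) cUDT.
have UTc : #|U :|: T| = #|(U :\ c) :|: T|.+1 by rewrite E (cardsD1 c (_ :|: _)) cUT.
rewrite Uc exprS -mulrA.
apply: le_trans (_ : (1 - x) * satw ((U :\ c) :|: T) <= _).
  rewrite ler_wpM2l ?(ltW y_gt0) // IH -?Uc //.
  by apply: leq_trans Un; rewrite UTc.
have -> : U :|: T = c |: ((U :\ c) :|: T) by rewrite E setD1K.
by apply: step; rewrite -?UTc // E setD11.
Qed.

Lemma local_lemma c S : (1 - x) * satw S <= satw (c |: S).
Proof.
elim: {S}_.+1 {-2}S (ltnSn #|S|) c => // n IH S; rewrite ltnS => Sn c.
have split : satw S = satw (c |: S) + expect p (fun s => (viol c s)%:R * (sat S s)%:R).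
  rewrite /satw /expect -big_split /=; apply: eq_bigr => s _.
  rewrite satU1; case: viol => /=; first by rewrite mul1r mulr0 add0r.
  by rewrite mul0r mulr0 addr0.
suff: expect p (fun s => (viol c s)%:R * (sat S s)%:R) <= x * satw S.
  by move=> H; rewrite mulrBl mul1r lerBlDr {1}split lerD2l.
apply: le_trans (expect_satD S _ (A := vb c) _) _ => //.
  by move=> s t st; rewrite (viol_dep st).
apply: le_trans (_ : pi * satw (S :\: touch (vb c)) <= _).
  by rewrite ler_wpM2r ?satw_ge0.
apply: le_trans (_ : x * (1 - x) ^+ N * satw (S :\: touch (vb c)) <= _).
  by rewrite ler_wpM2r ?satw_ge0.
rewrite -mulrA ler_wpM2l //.
have := @satw_setU n (S :&: touch (vb c)) (S :\: touch (vb c)).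
rewrite setID => /(_ _ Sn) H; apply: le_trans (H _) => [|d T dT Tn]; last first.
  exact: IH.
rewrite ler_wpM2r ?satw_ge0 // ler_wiXn2l ?(ltW y_gt0) //.
apply: leq_trans (touch_le c); apply: subset_leq_card.
by apply: subset_trans (subsetDl _ _) (subsetIr _ _).
Qed.

Lemma satw_gt0 S : 0 < satw S.
Proof.
have := @satw_setU #|S| S set0; rewrite setU0 setD0 satw0 mulr1 leqnn.
move=> H; apply: lt_le_trans (H _ isT); first by rewrite exprn_gt0.
by move=> c T _ _; exact: local_lemma.
Qed.

Lemma expect_sat_le A (f : config -> R) S m :
  (forall s, 0 <= f s) -> depends_on A f -> (#|touch A| <= m)%N ->
  (1 - x) ^+ m * expect p (fun s => f s * (sat S s)%:R) <= expect p f * satw S.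
Proof.
move=> f0 fA Am.
apply: le_trans (_ : (1 - x) ^+ m * (expect p f * satw (S :\: touch A)) <= _).
  by rewrite ler_wpM2l ?exprn_ge0 ?(ltW y_gt0) // expect_satD.
rewrite mulrCA ler_wpM2l ?expect_ge0 //.
have := @satw_setU #|S| (S :&: touch A) (S :\: touch A).
rewrite setID leqnn => H; apply: le_trans (H _ isT) => [|d T _ _]; last first.
  exact: local_lemma.
rewrite ler_wpM2r ?satw_ge0 // ler_wiXn2l ?(ltW y_gt0) //.
apply: leq_trans Am; apply: subset_leq_card.
by apply: subset_trans (subsetDl _ _) (subsetIr _ _).
Qed.

Lemma expect2_sat_le A (F : config -> config -> R) S m :
  (forall s t, 0 <= F s t) -> (forall t, depends_on A (F^~ t)) ->
  (forall s, depends_on A (F s)) -> (#|touch A| <= m)%N ->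
  (1 - x) ^+ (m + m) * (\sum_s \sum_t weight p s * weight p t *
      (F s t * (sat S s)%:R * (sat S t)%:R)) <=
  (\sum_s \sum_t weight p s * weight p t * F s t) * (satw S * satw S).
Proof.
move=> F0 FA1 FA2 Am.
pose g t := expect p (F^~ t).
have g0 t : 0 <= g t by exact: expect_ge0.
have gA : depends_on A g.
  by move=> t t' tt; apply: eq_bigr => s _; rewrite (FA2 s t t').
have -> : \sum_s \sum_t weight p s * weight p t * F s t = expect p g.
  rewrite exchange_big; apply: eq_bigr => t _; rewrite mulr_sumr.
  by apply: eq_bigr => s _; rewrite mulrCA mulrA.
have H := expect_sat_le S g0 gA Am; rewrite mulrA.
apply: le_trans (ler_wpM2r (satw_ge0 S) H).
rewrite exprD -!mulrA ler_wpM2l ?exprn_ge0 ?(ltW y_gt0) //.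
rewrite exchange_big {1}/expect mulr_suml mulr_sumr; apply: ler_sum => t _.
have := expect_sat_le S (fun s => F0 s t) (FA1 t) Am.
move/(ler_wpM2l (ler0n _ (sat S t)))/(ler_wpM2l (weight_ge0 p_ge0 t)).
congr (_ <= _); last by rewrite -/(g t); ring.
have -> : \sum_(s : config) weight p s * weight p t *
    (F s t * (sat S s)%:R * (sat S t)%:R) =
    weight p t * ((sat S t)%:R * expect p (fun s => F s t * (sat S s)%:R)).
  by rewrite /expect 2!mulr_sumr; apply: eq_bigr => s _; ring.
by ring.
Qed.

End LocalLemma.

Section Cluster.
Import mathcomp.boot.fintype mathcomp.boot.finset.
Variables (V C : finType) (vb : C -> {set V}).
Implicit Types (A X Y : {set V}) (B : pred C) (u v w : V) (c : C) (d : seq C).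

Local Notation touch := (touch vb).

Definition spread u B X : {set V} :=
  u |: \bigcup_(c in touch X | B c) vb c.

Definition cluster u B : {set V} := fixset (spread u B).

Lemma touchS X Y : X \subset Y -> touch X \subset touch Y.
Proof.
move=> XY; apply/subsetP => c; rewrite !inE; apply: contra.
by rewrite ![[disjoint vb c & _]]disjoint_sym; exact: disjointWl.
Qed.

Lemma touchP c X : reflect (exists2 v, v \in vb c & v \in X) (c \in touch X).
Proof.
rewrite inE; apply: (iffP idP) => [/pred0Pn[v /andP[]]|[v vc vX]].
  by exists v.
by apply/pred0Pn; exists v; rewrite /= vc.
Qed.

Lemma touchU X Y : touch (X :|: Y) = touch X :|: touch Y.
Proof.
apply/setP => c; apply/touchP/setUP => [[v vc /setUP[]]|[] /touchP[v vc vX]].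
- by left; apply/touchP; exists v.
- by right; apply/touchP; exists v.
- by exists v; rewrite // inE vX.
- by exists v; rewrite // inE vX orbT.
Qed.

Lemma spreadP u B X v :
  reflect (v = u \/ exists c, [/\ B c, c \in touch X & v \in vb c])
          (v \in spread u B X).
Proof.
rewrite in_setU1; apply: (iffP predU1P) => -[->|]; [by left| |by left|].
  by case/bigcupP => c /andP[ct Bc] vc; right; exists c.
by case=> c [Bc ct vc]; right; apply/bigcupP; exists c; rewrite ?ct.
Qed.

Lemma spread_mono u B : {homo spread u B : X Y / X \subset Y}.
Proof.
move=> X Y XY; apply/subsetP => v /spreadP[->|[c [Bc ct vc]]]; apply/spreadP.
  by left.
by right; exists c; split=> //; apply: (subsetP (touchS XY)).
Qed.

Lemma cluster_closed u B c :
  B c -> c \in touch (cluster u B) -> vb c \subset cluster u B.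
Proof.
move=> Bc ct; apply/subsetP => v vc.
rewrite /cluster -(fixsetK (@spread_mono u B)); apply/spreadP; right.
by exists c.
Qed.

Lemma eq_cluster u B B' : B =1 B' -> cluster u B = cluster u B'.
Proof. by move=> /boolp.funext->. Qed.

Section Layers.
Variables (u : V) (B : pred C).
Local Notation L n := (iter n (spread u B) set0).

Definition in_layer n c := [&& B c, c \in touch (L n.+1) & c \notin touch (L n)].

Lemma iter_spread_mono m n : (m <= n)%N -> L m \subset L n.
Proof. exact: (subset_iter (@spread_mono u B)). Qed.

Lemma layer_sub n c : in_layer n c -> vb c \subset L n.+2.
Proof.
case/and3P => Bc ct _; apply/subsetP => v vc; apply/spreadP; right.
by exists c.
Qed.

Lemma root_in n : u \in L n.+1.
Proof. by apply/spreadP; left. Qed.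

Lemma layer_pred n c : in_layer n.+1 c ->
  exists2 c', in_layer n c' & c \in touch (vb c').
Proof.
case/and3P => Bc /touchP[w wc wL] cL.
have wL' : w \notin L n.+1 by apply: contra cL => wL'; apply/touchP; exists w.
case/spreadP: (wL) => [E|[c' [Bc' c't wc']]].
  by rewrite E root_in in wL'.
exists c'; last by apply/touchP; exists w.
apply/and3P; split=> //; apply: contra wL' => c't'.
by apply/spreadP; right; exists c'.
Qed.

Lemma layer_of v : v \in cluster u B -> v != u ->
  exists n, (n < #|V|)%N /\ exists2 c, in_layer n c & v \in vb c.
Proof.
move=> vK vu.
have vK' : exists n, v \in L n by exists #|V|.
case: (ex_minnP vK') => -[|[|n]].
- by rewrite /= inE.
- by case/spreadP => [/eqP|[c [_ /touchP[w _]]]]; rewrite ?(negbTE vu) // inE.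
move=> vL vmin; have nV : (n.+2 <= #|V|)%N by exact: vmin.
case/spreadP: (vL) => [/eqP|[c [Bc ct vc]]]; first by rewrite (negbTE vu).
exists n; split; first by exact: ltn_trans nV.
exists c => //; apply/and3P; split=> //.
have : v \notin L n.+1 by apply/negP => /vmin; rewrite ltnn.
by apply: contra => ct'; apply/spreadP; right; exists c.
Qed.

End Layers.

(* A chain lists, last one first, bad constraints from every other
   breadth-first layer of the cluster.  Skipping the odd layers makes them
   pairwise disjoint, hence independent under the product measure. *)
Definition neighbors2 d : {set C} :=
  if d is c :: _ then \bigcup_(c' in touch (vb c)) touch (vb c') else set0.

Fixpoint chains u m : seq (seq C) :=
  if m is m'.+1
  then [seq c :: d | d <- chains u m', c <- enum (neighbors2 d)]
  else [seq [:: c] | c <- enum (touch [set u])].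

Definition reach d : {set V} :=
  if d is c :: _ then \bigcup_(c' in touch (vb c)) vb c' else set0.

Definition spaced d := pairwise (fun c c' => [disjoint vb c & vb c']) d.

Lemma chains_size u m d : d \in chains u m -> size d = m.+1.
Proof.
elim: m d => [|m IH] d /=; first by case/mapP => c _ ->.
by case/allpairsPdep => d' [c [d'm _ ->]] /=; rewrite IH.
Qed.

Lemma layer_chain u B m c : in_layer u B m.*2 c ->
  exists d, [/\ c :: d \in chains u m, all B (c :: d), spaced (c :: d) &
    all (fun e => vb e \subset iter m.*2 (spread u B) set0) d].
Proof.
elim: m c => [|m IH] c cl.
  exists [::]; case/and3P: cl => Bc /touchP[v vc vL] _; split=> //=.
  - apply/mapP; exists c => //; rewrite mem_enum; apply/touchP; exists v => //.
    by case/spreadP: vL => [->|[c' [_ /touchP[w _]]]]; rewrite !inE.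
  - by rewrite Bc.
have [c1 c1l ct1] := layer_pred cl; have [c2 c2l ct2] := layer_pred c1l.
have [d [dch dB dsp dL]] := IH _ c2l.
have dL' : all (fun e => vb e \subset iter m.+1.*2 (spread u B) set0) (c2 :: d).
  rewrite doubleS; apply/andP; split; first exact: layer_sub.
  apply: sub_all dL => e eL; apply: (subset_trans eL).
  by apply: iter_spread_mono; rewrite !leqW.
exists (c2 :: d); split=> //; case/and3P: cl => Bc ct ct'.
- apply/allpairsPdep; exists (c2 :: d), c; split=> //.
  by rewrite mem_enum; apply/bigcupP; exists c1.
- by rewrite /= Bc.
rewrite /spaced pairwise_cons; apply/andP; split=> //.
apply: sub_all dL' => e eL; rewrite inE negbK in ct'.
by rewrite disjoint_sym (disjointWl eL) // disjoint_sym.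
Qed.

Lemma cluster_chain u B v : v \in cluster u B -> v != u ->
  exists2 m, (m < #|V|)%N & exists2 d, d \in chains u m &
    [&& all B d, spaced d & v \in reach d].
Proof.
move=> vK vu; have [n [nV [c cl vc]]] := layer_of vK vu.
have [c' [c'l cc']] : exists c', in_layer u B n./2.*2 c' /\ c \in touch (vb c').
  have := odd_double_half n; case: (odd n) => /= E.
    by rewrite -E in cl; have [c' ? ?] := layer_pred cl; exists c'.
  rewrite add0n in E; rewrite E; exists c; split=> //.
  by apply/touchP; exists v.
have [d [d1 d2 d3 _]] := layer_chain c'l.
exists n./2.
  by apply: leq_ltn_trans nV; rewrite -{2}(odd_double_half n) -addnn addnA leq_addl.
exists (c' :: d) => //; rewrite d2 d3 /=.
by apply/bigcupP; exists c.
Qed.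

Variables (k D : nat).
Hypothesis card_vb : forall c, #|vb c| = k.
Hypothesis deg_le : forall v, (#|[set c | v \in vb c]| <= D)%N.

Lemma touch1 v : touch [set v] = [set c | v \in vb c].
Proof.
apply/setP => c; rewrite [RHS]inE; apply/touchP/idP => [[w wc]|vc].
  by rewrite inE => /eqP <-.
by exists v => //; rewrite inE.
Qed.

Lemma card_bigcup_le (I T : finType) (A : {set I}) (F : I -> {set T}) n :
  (forall i, i \in A -> (#|F i| <= n)%N) -> (#|\bigcup_(i in A) F i| <= #|A| * n)%N.
Proof.
move=> Fn; rewrite -sum_nat_const.
apply: (@leq_trans (\sum_(i in A) #|F i|)%N); last exact: leq_sum.
elim/big_rec2: _ => [|i m X _ H]; first by rewrite cards0.
by apply: leq_trans (leq_card_setU _ _) _; rewrite leq_add2l.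
Qed.

Lemma card_touch A : (#|touch A| <= #|A| * D)%N.
Proof.
have -> : touch A = \bigcup_(v in A) touch [set v].
  apply/setP => c; apply/touchP/bigcupP => -[v].
    by move=> vc vA; exists v => //; rewrite touch1 inE.
  by move=> vA; rewrite touch1 inE => vc; exists v.
by apply: card_bigcup_le => v _; rewrite touch1.
Qed.

Lemma card_touch_vb c : (#|touch (vb c)| <= D * k)%N.
Proof. by rewrite mulnC -(card_vb c) card_touch. Qed.

Lemma card_neighbors2 d : (#|neighbors2 d| <= (D * k) ^ 2)%N.
Proof.
case: d => [|c d] /=; first by rewrite cards0.
apply: leq_trans (card_bigcup_le (fun c' _ => card_touch_vb c')) _.
by rewrite leq_mul2r card_touch_vb orbT.
Qed.

Lemma card_reach d : (#|reach d| <= D * k * k)%N.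
Proof.
case: d => [|c d] /=; first by rewrite cards0.
apply: leq_trans (card_bigcup_le (n := k) _) _ => [c' _|]; first by rewrite card_vb.
by rewrite leq_mul2r card_touch_vb orbT.
Qed.

Lemma size_chains u m : (size (chains u m) <= D * ((D * k) ^ 2) ^ m)%N.
Proof.
elim: m => [|m IH] /=; first by rewrite size_map -cardE touch1 muln1.
rewrite size_allpairs_dep expnSr mulnA.
apply: leq_trans (_ : size (chains u m) * (D * k) ^ 2 <= _)%N; last first.
  by rewrite leq_mul2r IH orbT.
elim: (chains u m) => //= d s IHs; rewrite mulSn leq_add //.
by rewrite -cardE card_neighbors2.
Qed.

Lemma card_cluster_le (R : realFieldType) u B :
  #|cluster u B|%:R <= 1 + \sum_(m < #|V|) \sum_(d <- chains u m)
     (all B d && spaced d)%:R * (D * k * k)%:R :> R.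
Proof.
have -> : 1 + \sum_(m < #|V|) \sum_(d <- chains u m)
     (all B d && spaced d)%:R * (D * k * k)%:R =
   (1 + \sum_(m < #|V|) \sum_(d <- chains u m)
     (all B d && spaced d) * (D * k * k))%:R :> R.
  rewrite natrD natr_sum; congr (_ + _); apply: eq_bigr => m _.
  by rewrite natr_sum; apply: eq_bigr => d _; rewrite -natrM.
rewrite ler_nat.
apply: leq_trans (_ : #|[set u]| + #|\bigcup_(m < #|V|)
    \bigcup_(d <- chains u m | all B d && spaced d) reach d| <= _)%N.
  apply: leq_trans (leq_card_setU _ _); apply: subset_leq_card.
  apply/subsetP => v vK; rewrite !inE; have [//|vu] := eqVneq v u.
  have [m mV [d dm /and3P[dB ds vd]]] := cluster_chain vK vu.
  apply/bigcupP; exists (Ordinal mV) => //=.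
  by rewrite (big_rem d) //= dB ds /= inE vd.
rewrite cards1 leq_add2l.
elim/big_rec2: _ => [|m x X _ H]; first by rewrite cards0.
apply: leq_trans (leq_card_setU _ _) _; rewrite leq_add //.
elim: (chains u m) => [|d s IHs]; first by rewrite !big_nil cards0.
rewrite !big_cons; case: ifP => _; last by rewrite mul0n add0n.
by apply: leq_trans (leq_card_setU _ _) _; rewrite leq_add // mul1n card_reach.
Qed.

End Cluster.

Section Variance.
Import mathcomp.boot.fintype mathcomp.boot.finset.
Variables (R : realFieldType) (Q V C : finType) (p : Q -> R).
Hypothesis p_ge0 : forall a, 0 <= p a.
Hypothesis p_sum1 : \sum_a p a = 1.
Variables (vb : C -> {set V}) (act : pred C) (bet : C -> V -> Q).
Local Notation config := {ffun V -> Q}.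
Implicit Types (A : {set V}) (s t : config) (u v : V) (c : C) (d : seq C).

Local Notation sat := (sat vb act bet setT).
Local Notation Z := (satw p vb act bet setT).

Definition bad s t c :=
  act c && [forall v in vb c, (bet c v == s v) || (bet c v == t v)].

Definition pair_sat (f : config -> config -> R) : R :=
  \sum_s \sum_t weight p s * weight p t * (f s t * (sat s)%:R * (sat t)%:R).

Lemma pair_satD f g :
  pair_sat (fun s t => f s t + g s t) = pair_sat f + pair_sat g.
Proof.
rewrite /pair_sat -big_split; apply: eq_bigr => s _ /=; rewrite -big_split.
by apply: eq_bigr => t _ /=; ring.
Qed.

Lemma pair_satZ a f : pair_sat (fun s t => a * f s t) = a * pair_sat f.
Proof.
rewrite /pair_sat mulr_sumr; apply: eq_bigr => s _ /=; rewrite mulr_sumr.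
by apply: eq_bigr => t _ /=; ring.
Qed.

Lemma eq_pair_sat f g :
  (forall s t, sat s -> sat t -> f s t = g s t) -> pair_sat f = pair_sat g.
Proof.
move=> fg; apply: eq_bigr => s _; apply: eq_bigr => t _; congr (_ * _).
by case: (boolP (sat s)) => ss; case: (boolP (sat t)) => st;
  rewrite ?mulr0 ?mulr1 //; exact: fg.
Qed.

Lemma pair_sat_sum I (l : seq I) (f : I -> config -> config -> R) :
  pair_sat (fun s t => \sum_(i <- l) f i s t) = \sum_(i <- l) pair_sat (f i).
Proof.
elim: l => [|i l IH].
  rewrite big_nil /pair_sat; apply: big1 => s _; apply: big1 => t _.
  by rewrite big_nil !mul0r mulr0.
rewrite big_cons -IH -pair_satD; apply: eq_pair_sat => s t _ _.
by rewrite big_cons.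
Qed.

Lemma ler_pair_sat f g : (forall s t, f s t <= g s t) -> pair_sat f <= pair_sat g.
Proof.
move=> fg; apply: ler_sum => s _; apply: ler_sum => t _.
rewrite ler_wpM2l ?mulr_ge0 ?weight_ge0 //.
by rewrite !ler_wpM2r ?ler0n.
Qed.

Lemma pair_sat1 : pair_sat (fun _ _ => 1) = Z * Z.
Proof.
rewrite /satw /expect big_distrlr /=; apply: eq_bigr => s _.
by apply: eq_bigr => t _; ring.
Qed.

Lemma viol_bad s t c A : viol vb act bet c (glue A s t) -> bad s t c.
Proof.
case/andP=> ac /forall_inP H; rewrite /bad ac.
apply/forall_inP => v vc; move: (H v vc).
by rewrite ffunE; case: (v \in A) => /eqP ->; rewrite eqxx ?orbT.
Qed.

Lemma bad_glue s t A : bad (glue A s t) (glue A t s) =1 bad s t.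
Proof.
move=> c; congr (_ && _); apply: eq_forallb => v; rewrite !ffunE.
by case: (v \in A) => //; rewrite orbC.
Qed.

Definition pair_cluster u s t := cluster vb u (bad s t).

Lemma pair_cluster_glue u s t A :
  pair_cluster u (glue A s t) (glue A t s) = pair_cluster u s t.
Proof. exact: (eq_cluster _ _ (bad_glue s t A)). Qed.

Lemma sat_glue u s t : sat s -> sat t -> sat (glue (pair_cluster u s t) s t).
Proof.
move=> /forall_inP ss /forall_inP st; apply/forall_inP => c cT.
apply/negP => cv; have cb := viol_bad cv.
case/andP: cv => ac /forall_inP cv.
have [ct|] := boolP (c \in touch vb (pair_cluster u s t)).
  have /subsetP cK := cluster_closed cb ct.
  have /negP := st c cT; apply; apply/andP; split=> //.
  by apply/forall_inP => v vc; have := cv v vc; rewrite ffunE cK.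
move=> ct; have /negP := ss c cT; apply; apply/andP; split=> //.
apply/forall_inP => v vc; have := cv v vc; rewrite ffunE.
case: (boolP (v \in _)) => // vK; case/negP: ct.
by apply/touchP; exists v.
Qed.

Lemma sat_glueE u s t :
  sat (glue (pair_cluster u s t) s t) && sat (glue (pair_cluster u s t) t s) =
  sat s && sat t.
Proof.
have sym s' t' : pair_cluster u s' t' = pair_cluster u t' s'.
  apply: eq_cluster => c; congr (_ && _); apply: eq_forallb => v.
  by rewrite orbC.
have fwd s' t' : sat s' && sat t' ->
    sat (glue (pair_cluster u s' t') s' t') && sat (glue (pair_cluster u s' t') t' s').
  by case/andP => ? ?; rewrite sat_glue //= sym sat_glue.
apply/idP/idP => [/fwd|]; last exact: fwd.
by rewrite pair_cluster_glue !glueK.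
Qed.

Lemma pair_sat_swap u f :
  pair_sat f = pair_sat (fun s t =>
    f (glue (pair_cluster u s t) s t) (glue (pair_cluster u s t) t s)).
Proof.
rewrite /pair_sat (@expect_swap _ _ _ _ (pair_cluster u)); last first.
  by move=> s t; rewrite pair_cluster_glue.
apply: eq_bigr => s _; apply: eq_bigr => t _; congr (_ * _).
rewrite -![_ * _%:R * _]mulrA -!natrM !mulnb; congr (_ * (nat_of_bool _)%:R).
exact: sat_glueE.
Qed.

Section Observable.
Variable h : Q -> R.
Hypothesis h01 : forall a, 0 <= h a <= 1.

(* Exchanging s and t on the cluster of u flips the sign of the first factor
   but, for v outside the cluster, not of the second one. *)
Lemma pair_cov_le u v :
  pair_sat (fun s t => (h (s u) - h (t u)) * (h (s v) - h (t v))) <=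
  pair_sat (fun s t => (v \in pair_cluster u s t)%:R).
Proof.
pose g s t := (h (s u) - h (t u)) * (h (s v) - h (t v)).
pose o s t := (v \notin pair_cluster u s t)%:R * g s t.
have o0 : pair_sat o = 0.
  suff : pair_sat o = - pair_sat o by lra.
  rewrite {1}(pair_sat_swap u) -mulN1r -pair_satZ; apply: eq_pair_sat => s t _ _.
  rewrite /o pair_cluster_glue; case: (boolP (v \in _)) => vK.
    by rewrite !mul0r mulr0.
  have uK : u \in pair_cluster u s t.
    rewrite /pair_cluster /cluster -(fixsetK (@spread_mono _ _ vb u (bad s t))).
    by apply/spreadP; left.
  by rewrite /g !ffunE uK (negbTE vK) !mul1r; ring.
rewrite -[X in _ <= X]addr0 -o0 -pair_satD; apply: ler_pair_sat => s t.
rewrite /o /g; case: (v \in _) => /=; last by rewrite mul1r add0r.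
rewrite mul0r addr0.
have := h01 (s u); have := h01 (s v); have := h01 (t u); have := h01 (t v).
by nra.
Qed.

End Observable.

Variables (k D : nat) (r x theta : R).
Hypothesis card_vb : forall c, #|vb c| = k.
Hypothesis deg_le : forall v, (#|[set c | v \in vb c]| <= D)%N.
Hypothesis N_gt0 : (0 < D * k)%N.
Hypothesis p_le : forall a, p a <= r.
Hypothesis r_le1 : r <= 1.
Hypothesis r_ge0 : 0 <= r.
Hypothesis x_ge0 : 0 <= x.
Hypothesis x_lt1 : x < 1.
Hypothesis viol_small : r ^+ k <= x * (1 - x) ^+ (D * k).
Hypothesis theta_ge0 : 0 <= theta.
Hypothesis theta_lt1 : theta < 1.
Hypothesis bad_small :
  (D * k)%:R ^+ 2 * (r * (2 - r)) ^+ k <= theta * (1 - x) ^+ (D * k + D * k).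

Lemma viol_prob c : expect p (fun s => (viol vb act bet c s)%:R) <= r ^+ k.
Proof.
apply: le_trans (_ : expect p (fun s => [forall v in vb c, s v == bet c v]%:R) <= _).
  apply: ler_expect => // s; rewrite ler_nat /viol.
  by case: (act c).
by rewrite -(card_vb c); exact: expect_pin.
Qed.

Definition chain_vars d : {set V} := \bigcup_(c <- d) vb c.

Lemma chain_varsP d v : reflect (exists2 c, c \in d & v \in vb c) (v \in chain_vars d).
Proof.
rewrite /chain_vars; elim: d => [|c d IH].
  by rewrite big_nil inE; constructor => -[].
rewrite big_cons; apply: (iffP setUP) => [[vc|/IH[c' c'd vc']]|[c']].
- by exists c; rewrite ?mem_head.
- by exists c'; rewrite // inE c'd orbT.
by rewrite inE => /predU1P[->|c'd] vc'; [left|right; apply/IH; exists c'].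
Qed.

Lemma card_chain_vars d : spaced vb d -> #|chain_vars d| = (k * size d)%N.
Proof.
rewrite /chain_vars; elim: d => [|c d IH]; first by rewrite big_nil cards0 muln0.
rewrite /spaced pairwise_cons => /andP[/allP cd ds]; rewrite big_cons cardsU IH //.
suff -> : vb c :&: \bigcup_(c' <- d) vb c' = set0 by rewrite cards0 subn0 card_vb mulnS.
apply/setP => v; rewrite !inE; apply/negP => /andP[vc /chain_varsP[c' c'd vc']].
by have := disjointFr (cd _ c'd) vc; rewrite vc'.
Qed.

Lemma card_touch_chain d : (#|touch vb (chain_vars d)| <= D * k * size d)%N.
Proof.
rewrite /chain_vars; elim: d => [|c d IH].
  by rewrite big_nil muln0 (leq_trans (card_touch deg_le _)) // cards0.
rewrite big_cons touchU mulnS; apply: leq_trans (leq_card_setU _ _) _.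
by rewrite leq_add // card_touch_vb.
Qed.

Lemma bad_dep1 A d t : {subset chain_vars d <= A} ->
  depends_on A (fun s => all (bad s t) d).
Proof.
move=> dA s s' ss; apply: eq_in_all => c cd; congr (_ && _).
apply: eq_forallb => v; case: (boolP (v \in vb c)) => // vc.
by rewrite ss //; apply: dA; apply/chain_varsP; exists c.
Qed.

Lemma bad_dep2 A d s : {subset chain_vars d <= A} ->
  depends_on A (fun t => all (bad s t) d).
Proof.
move=> dA t t' tt; apply: eq_in_all => c cd; congr (_ && _).
apply: eq_forallb => v; case: (boolP (v \in vb c)) => // vc.
by rewrite tt //; apply: dA; apply/chain_varsP; exists c.
Qed.

Definition pin c0 d v := bet (nth c0 d (find (fun c => v \in vb c) d)) v.

Lemma all_bad_pinned c0 d s t : all (bad s t) d ->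
  [forall v in chain_vars d, (pin c0 d v == s v) || (pin c0 d v == t v)].
Proof.
move=> /allP H; apply/forall_inP => v /chain_varsP[c cd vc].
have hd : has (fun c => v \in vb c) d by apply/hasP; exists c.
have /H/andP[_ /forall_inP Hv] : nth c0 d (find (fun c => v \in vb c) d) \in d.
  by rewrite mem_nth // -has_find.
exact: Hv (nth_find c0 hd).
Qed.

Lemma bad_chain_prob d : spaced vb d ->
  pair_sat (fun s t => (all (bad s t) d)%:R) <=
  (theta / (D * k)%:R ^+ 2) ^+ size d * (Z * Z).
Proof.
have N0 : 0 < (D * k)%:R ^+ 2 :> R by rewrite exprn_gt0 // ltr0n.
have y0 : 0 < 1 - x by rewrite subr_gt0.
have Z0 := satw_ge0 p_ge0 vb act bet setT.
case: d => [_|c0 d'].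
  by rewrite mul1r -pair_sat1; apply: ler_pair_sat => s t; rewrite lexx.
set d := c0 :: d' => ds.
rewrite -(ler_pM2l (exprn_gt0 (D * k * size d + D * k * size d) y0)).
apply: le_trans (expect2_sat_le p_ge0 p_sum1 (card_touch_vb card_vb deg_le) viol_prob
  x_ge0 x_lt1 viol_small setT _ _ _ (card_touch_chain d)) _.
- by move=> s t; rewrite ler0n.
- by move=> t s s' ss; rewrite (@bad_dep1 _ d t _ _ _ ss).
- by move=> s t t' tt; rewrite (@bad_dep2 _ d s _ _ _ tt).
rewrite [X in _ <= X]mulrA ler_wpM2r ?mulr_ge0 //.
apply: le_trans (_ : ((r * (2 - r)) ^+ k) ^+ size d <= _).
  rewrite -exprM -(card_chain_vars ds).
  apply: le_trans (expect_pin2 p_ge0 p_sum1 _ (pin c0 d) p_le r_le1).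
  apply: ler_sum => s _; apply: ler_sum => t _.
  rewrite ler_wpM2l ?mulr_ge0 ?weight_ge0 // ler_nat.
  by case: (boolP (all _ _)) => // /(all_bad_pinned c0) ->.
rewrite -mulnDl exprM -exprMn; apply: lerXn2r; rewrite ?nnegrE.
- by rewrite exprn_ge0 // mulr_ge0 // subr_ge0 (le_trans r_le1) // ler1n.
- by rewrite mulr_ge0 ?exprn_ge0 ?(ltW y0) ?divr_ge0 ?(ltW N0) //.
by rewrite mulrA ler_pdivlMr // mulrC [X in _ <= X]mulrC.
Qed.

Lemma pair_cluster_mean u :
  pair_sat (fun s t => #|pair_cluster u s t|%:R) <= (1 - theta)^-1 * (Z * Z).
Proof.
have N0 : (D * k)%:R != 0 :> R by rewrite pnatr_eq0 -lt0n.
have Z0 := satw_ge0 p_ge0 vb act bet setT.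
apply: le_trans
  (ler_pair_sat (fun s t => card_cluster_le card_vb deg_le R u (bad s t))) _.
rewrite pair_satD pair_sat1 pair_sat_sum.
apply: le_trans (_ : Z * Z + \sum_(m < #|V|) theta ^+ m.+1 * (Z * Z) <= _).
  rewrite lerD2l; apply: ler_sum => m _; rewrite pair_sat_sum.
  pose a : R := (theta / (D * k)%:R ^+ 2) ^+ m.+1 * (Z * Z) * (D * k * k)%:R.
  have a0 : 0 <= a.
    by rewrite !mulr_ge0 ?ler0n ?exprn_ge0 ?divr_ge0 ?exprn_ge0 ?ler0n.
  apply: le_trans (_ : \sum_(d <- chains vb u m) a <= _).
    rewrite big_seq [X in _ <= X]big_seq; apply: ler_sum => d dm.
    rewrite (eq_pair_sat (g := fun s t =>
        (D * k * k)%:R * (all (bad s t) d && spaced vb d)%:R)); last first.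
      by move=> s t _ _; rewrite mulrC.
    rewrite pair_satZ mulrC /a ler_wpM2r ?ler0n // -(chains_size dm).
    case: (boolP (spaced vb d)) => ds.
      apply: le_trans (bad_chain_prob ds); apply: ler_pair_sat => s t.
      by rewrite andbT.
    rewrite (eq_pair_sat (g := fun s t => 0 * 1)); last first.
      by move=> s t _ _; rewrite andbF mul0r.
    by rewrite pair_satZ mul0r !mulr_ge0 ?exprn_ge0 ?divr_ge0 ?exprn_ge0 ?ler0n.
  rewrite big_const_seq count_predT iter_addr_0.
  apply: le_trans (_ : a *+ (D * ((D * k) ^ 2) ^ m) <= _).
    exact: ler_wpMn2l a0 _ _ (size_chains card_vb deg_le u m).
  rewrite le_eqVlt; apply/orP; left; apply/eqP.
  rewrite -mulr_natr /a [(D * k * k)%:R]natrM [(D * _ ^ m)%:R]natrM !natrX.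
  rewrite expr_div_n ![(_ ^+ 2) ^+ m.+1]exprS; move: N0; rewrite natrM => N0.
  have : ((D%:R * k%:R : R) ^+ 2) ^+ m != 0 by rewrite !expf_neq0.
  move: N0; set y := (_ ^+ 2) ^+ m; rewrite mulf_eq0 negb_or => /andP[D0 k0] y0.
  by field; rewrite ?D0 ?k0 ?y0.
rewrite -mulr_suml -{1}[Z * Z]mul1r -mulrDl ler_wpM2r ?mulr_ge0 //.
have t0 : 0 < 1 - theta by rewrite subr_gt0.
rewrite -div1r ler_pdivlMr // mulrC.
have -> : (1 - theta) * (1 + \sum_(m < #|V|) theta ^+ m.+1) = 1 - theta ^+ #|V|.+1.
  rewrite -[1 in RHS](expr1n _ #|V|.+1) subrXX big_ord_recl /=.
  rewrite expr1n expr0 mulr1; congr (_ * (_ + _)); apply: eq_bigr => m _.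
  by rewrite expr1n mul1r.
by rewrite lerBlDr lerDl exprn_ge0.
Qed.

Lemma pair_sat_variance (h : Q -> R) : (forall a, 0 <= h a <= 1) ->
  pair_sat (fun s t => (\sum_v h (s v) - \sum_v h (t v)) ^+ 2) <=
  #|V|%:R * ((1 - theta)^-1 * (Z * Z)).
Proof.
move=> h01.
rewrite (eq_pair_sat (g := fun s t => \sum_u \sum_v
    (h (s u) - h (t u)) * (h (s v) - h (t v)))); last first.
  by move=> s t _ _; rewrite -sumrB expr2 big_distrlr.
rewrite pair_sat_sum mulr_natl -sumr_const; apply: ler_sum => u _.
apply: le_trans (pair_cluster_mean u); rewrite pair_sat_sum.
apply: le_trans (ler_sum _ (fun v _ => pair_cov_le h01 u v)) _.
rewrite -pair_sat_sum; apply: ler_pair_sat => s t.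
rewrite -sum1_card natr_sum [X in _ <= X]big_mkcond /= ler_sum // => v _.
by case: (v \in _).
Qed.

End Variance.

Lemma chebyshev_pair (R : realType) (T : finType) (mu X : T -> R) (a : R) :
  (forall s, 0 <= mu s) -> \sum_s mu s = 1 -> 0 <= a ->
  2 * (Pr mu (fun s => `|X s - Ex mu X| >= a) * a ^+ 2) <=
  \sum_s \sum_t mu s * mu t * (X s - X t) ^+ 2.
Proof.
move=> mu0 mu1 a0; set m := Ex mu X; pose A s := X s - m.
have A0 : \sum_s mu s * A s = 0.
  rewrite (eq_bigr (fun s => mu s * X s - mu s * m)).
    by rewrite sumrB -mulr_suml mu1 mul1r subrr.
  by move=> s _; rewrite mulrBr.
have -> : \sum_s \sum_t mu s * mu t * (X s - X t) ^+ 2 = 2 * \sum_s mu s * A s ^+ 2.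
  rewrite (eq_bigr (fun s => mu s * A s ^+ 2 + mu s * (\sum_t mu t * A t ^+ 2) -
      2 * (mu s * A s) * \sum_t mu t * A t)).
    rewrite sumrB big_split /= -mulr_suml mu1 -!mulr_suml A0; ring.
  move=> s _; have -> : mu s * A s ^+ 2 = \sum_t mu s * A s ^+ 2 * mu t.
    by rewrite -mulr_sumr mu1 mulr1.
  rewrite !mulr_sumr -big_split -sumrB /=.
  by apply: eq_bigr => t _; rewrite /A; ring.
rewrite ler_pM2l // /Pr mulr_suml big_mkcond; apply: ler_sum => s _.
case: ifP => [H|_]; last by rewrite mulr_ge0 ?sqr_ge0.
by rewrite ler_wpM2l // -[A s ^+ 2]real_normK ?num_real // lerXn2r ?nnegrE.
Qed.

(* With r = exp (- M) and 2 - r = exp L the exponent of y is 2 M / (M - L):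
   raising the hypothesis to the power (M - L) / M turns r into r (2 - r) and
   the exponent of y into 2. *)
Lemma powR_zeta (R : realType) (r y : R) (n : nat) : 0 < r -> r < 1 -> 1 <= y ->
  r ^+ n * y `^ (2 + 2 * ln (2 - r) / (ln (1 / r) - ln (2 - r))) <= 1 ->
  (r * (2 - r)) ^+ n * y ^+ 2 <= 1.
Proof.
move=> r0 r1 y1; have y0 : 0 < y by lra.
have r20 : 0 < 2 - r by lra.
have s0 : 0 < r * (2 - r) by rewrite mulr_gt0.
have dpos : 0 < ln (1 / r) - ln (2 - r).
  rewrite div1r lnV ?posrE // -opprD -lnM ?posrE // oppr_gt0 ln_lt0 //.
  by rewrite s0 /=; nra.
set d := ln (1 / r) - ln (2 - r) in dpos *.
rewrite -ler_ln ?posrE ?mulr_gt0 ?exprn_gt0 ?powR_gt0 //.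
rewrite lnM ?posrE ?exprn_gt0 ?powR_gt0 // ln1 lnXn // ln_powR => H.
rewrite -ler_ln ?posrE ?mulr_gt0 ?exprn_gt0 // ln1 lnM ?posrE ?exprn_gt0 //.
rewrite !lnXn // lnM ?posrE //.
have E : d = - ln r - ln (2 - r) by rewrite /d div1r lnV ?posrE.
have dn0 : d != 0 by rewrite gt_eqF.
have E2 : 2 + 2 * ln (2 - r) / d = 2 * (- ln r) / d by rewrite E in dn0 *; field.
move: H; rewrite E2 -[ln r *+ n]mulr_natl -[(ln r + _) *+ n]mulr_natl.
rewrite -[ln y *+ 2]mulr_natl.
have -> : n%:R * ln r + 2 * - ln r / d * ln y =
  (- ln r / d) * (n%:R * (ln r + ln (2 - r)) + 2%:R * ln y).
  by rewrite E in dn0 *; field.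
rewrite pmulr_rle0 // divr_gt0 // oppr_gt0 ln_lt0 //.
by rewrite r0.
Qed.

Lemma bernoulli_ler (R : realFieldType) (x : R) n : 0 <= x <= 1 ->
  1 - n%:R * x <= (1 - x) ^+ n.
Proof.
move=> /andP[x0 x1]; elim: n => [|n IH]; first by rewrite mul0r subr0.
rewrite exprS; apply: le_trans (_ : (1 - x) * (1 - n%:R * x) <= _).
  have := ler0n R n; rewrite -natr1 => n0.
  have : 0 <= n%:R * (x * x) by rewrite !mulr_ge0.
  by lra.
by rewrite ler_wpM2l // subr_ge0.
Qed.

Section GibbsWeight.
Import mathcomp.boot.fintype mathcomp.boot.finset.
Variables (R : realType) (n : nat) (V C : finType).
Local Notation q := n.+2.
Variables (Phi : csp_formula q V C) (lambda : R).
Hypothesis lambda_gt0 : 0 < lambda.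
Hypothesis atomicPhi : atomic Phi.

Definition value_weight (a : 'I_q) : R :=
  (if a == ord0 then lambda else 1) / (q%:R - 1 + lambda).

Definition has_violation (c : C) : bool := violating Phi c != set0.

(* The value ord0 is junk, for c never violated or v not a variable of c. *)
Definition violating_value (c : C) (v : V) : 'I_q :=
  if [pick l in violating Phi c] is Some l
  then (if insub v is Some z then l z else ord0) else ord0.

Let W_gt0 : 0 < q%:R - 1 + lambda.
Proof. by rewrite -natr1 addrK ltr_wpDl. Qed.

Lemma value_weight_ge0 a : 0 <= value_weight a.
Proof. by apply: divr_ge0 (ltW W_gt0); case: ifP => // _; exact: ltW. Qed.

Lemma value_weight_sum1 : \sum_a value_weight a = 1.
Proof.
rewrite -mulr_suml big_ord_recl eqxx (eq_bigr (fun=> 1)) => [|i _ //].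
rewrite sumr_const card_ord -natr1 addrK addrC divff //.
by have := W_gt0; rewrite -natr1 addrK lt0r => /andP[].
Qed.

Lemma value_weight_le a : value_weight a <= r_max q lambda.
Proof.
rewrite ler_wpM2r ?invr_ge0 ?(ltW W_gt0) //.
by case: ifP => _; rewrite le_max lexx ?orbT.
Qed.

Lemma weight_value (s : assignment q V) :
  weight value_weight s = lambda ^+ #|ones s| / (q%:R - 1 + lambda) ^+ #|V|.
Proof.
rewrite /weight prodf_div prodr_const; congr (_ / _).
rewrite -prodr_const big_mkcond [in RHS]big_mkcond; apply: eq_bigr => v _.
by rewrite inE /=; case: (s v) => -[|m] mq.
Qed.

Lemma viol_restrict c s :
  viol (vbl Phi) has_violation violating_value c s =
  (Defs.restrict (vbl Phi c) s \in violating Phi c).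
Proof.
rewrite /viol /has_violation /violating_value.
case: pickP => [l lc|none]; last first.
  have -> : violating Phi c = set0 by apply/setP => l; rewrite none inE.
  by rewrite eqxx inE.
have -> : violating Phi c != set0 by apply/set0Pn; exists l.
have one l' : l' \in violating Phi c -> l' = l.
  have /card_le1_eqP H := atomicPhi c; move=> l'c; exact: H.
apply/forall_inP/idP => [H|/one E v vc].
  suff -> : Defs.restrict (vbl Phi c) s = l by [].
  apply/ffunP => z; rewrite ffunE; apply/eqP.
  by have := H (val z) (valP z); rewrite valK.
case: insubP => [z _ zv|]; last by rewrite vc.
by rewrite -E ffunE zv.
Qed.

Lemma sat_satisfying s :
  sat (vbl Phi) has_violation violating_value setT s = (s \in satisfying Phi).
Proof.
rewrite inE; apply: eq_forallb => c.
by rewrite inE viol_restrict.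
Qed.

Let Zs := satw value_weight (vbl Phi) has_violation violating_value setT.

Lemma gibbs_weight s : 0 < Zs -> gibbs Phi lambda s =
  weight value_weight s *
    (sat (vbl Phi) has_violation violating_value setT s)%:R / Zs.
Proof.
move=> Z0; rewrite /gibbs sat_satisfying.
case: (boolP (s \in _)) => sS; last by rewrite mulr0 mul0r.
have -> : Zs = partition_function Phi lambda / (q%:R - 1 + lambda) ^+ #|V|.
  rewrite /Zs /satw /expect /partition_function mulr_suml [RHS]big_mkcond.
  apply: eq_bigr => t _; rewrite sat_satisfying weight_value.
  by case: (t \in _); rewrite ?mulr0 ?mulr1.
have Wn0 : (q%:R - 1 + lambda) ^+ #|V| != 0 by rewrite expf_neq0 // gt_eqF.
rewrite weight_value mulr1 invf_div mulrA; congr (_ / _).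
by rewrite divfK.
Qed.

End GibbsWeight.

Lemma expect_coord (R : realFieldType) (Q V : finType) (p h : Q -> R) (v : V) :
  \sum_a p a = 1 ->
  expect p (fun s : {ffun V -> Q} => h (s v)) = \sum_a p a * h a.
Proof.
move=> p1; pose F u a := p a * (if u == v then h a else 1).
transitivity (\sum_(s : {ffun V -> Q}) \prod_u F u (s u)).
  apply: eq_bigr => s _; rewrite big_split /=; congr (_ * _).
  by rewrite -big_mkcond big_pred1_eq.
rewrite -(bigA_distr_bigA F) (bigD1 v) //= [X in _ * X]big1 ?mulr1.
  by apply: eq_bigr => a _; rewrite /F eqxx.
by move=> u /negbTE uv; rewrite -[RHS]p1; apply: eq_bigr => a _; rewrite /F uv mulr1.
Qed.

Section NumericBounds.
Variables (R : realType) (n k D : nat) (lambda : R).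
Local Notation q := n.+2.
Local Notation r := (r_max q lambda).
Local Notation M := (Num.max 1 (1 / lambda)).
Hypothesis lambda_gt0 : 0 < lambda.
Hypothesis D_gt0 : (0 < D)%N.
Hypothesis hcond : (8 * expR 1) ^+ 3 * M * r ^ (k%:Z - 1)
  * (D%:R * k%:R + 1) `^ (2 + zeta q lambda) <= 1.

Let q1 : q%:R - 1 = n.+1%:R :> R. Proof. by rewrite -natr1 addrK. Qed.

Let n0 : 0 < n.+1%:R :> R. Proof. by rewrite ltr0n. Qed.

Let n1 : 1 <= n.+1%:R :> R. Proof. by rewrite ler1n. Qed.

Lemma r_max_gt0 : 0 < r.
Proof. by rewrite divr_gt0 ?lt_max ?ltr01 // q1 addr_gt0. Qed.

Lemma r_max_lt1 : r < 1.
Proof.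
rewrite ltr_pdivrMr q1 ?addr_gt0 // mul1r gt_max.
by apply/andP; split; move: n1 n0 lambda_gt0 => *; lra.
Qed.

Lemma r_maxE : r = lambda / (q%:R - 1 + lambda) * M.
Proof.
rewrite /r_max mulrAC; congr (_ / _); rewrite maxr_pMr ?ltW //.
by rewrite mulr1 mulrCA divff ?mulr1 ?gt_eqF // maxC.
Qed.

Let M_ge1 : 1 <= M. Proof. by rewrite le_max lexx. Qed.

Let const_ge : 512 <= (8 * expR 1) ^+ 3 :> R.
Proof.
have e1 : 1 <= expR 1 :> R by have := expR_ge1Dx (1 : R); lra.
have -> : 512 = 8 ^+ 3 :> R by ring.
apply: lerXn2r; rewrite ?nnegrE; lra.
Qed.

Let zeta_ge0 : 0 <= zeta q lambda.
Proof.
rewrite /zeta /=; move: r_max_gt0 r_max_lt1; move: (r_max q lambda) => y y0 y1.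
have y2 : 0 < 2 - y by lra.
apply: divr_ge0; first by (rewrite mulr_ge0 // ln_ge0 //; lra).
rewrite subr_ge0 ler_ln ?posrE ?divr_gt0 //.
by rewrite ler_pdivlMr //; nra.
Qed.

Let y_ge1 : 1 <= D%:R * k%:R + 1 :> R.
Proof. by rewrite lerDr mulr_ge0. Qed.

Let sq_le : (D%:R * k%:R + 1) ^+ 2 <=
  (D%:R * k%:R + 1) `^ (2 + zeta q lambda) :> R.
Proof.
rewrite -powR_mulrn; last by move: y_ge1; lra.
by apply: ler_powR => //; move: zeta_ge0; lra.
Qed.

Lemma cond_k_gt0 : (0 < k)%N.
Proof.
rewrite lt0n; apply/eqP => k0; move: hcond; rewrite leNgt => /negP; apply.
have z1 := sq_le; rewrite k0 mulr0 add0r expr1n in z1 *.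
have ri : 1 <= r ^ (0%N%:Z - 1).
  by rewrite sub0r exprN1 invf_ge1 ?r_max_gt0 ?ltW ?r_max_lt1.
have C1 : 1 < (8 * expR 1) ^+ 3 :> R by apply: lt_le_trans const_ge; rewrite ltr1n.
move: ((8 * expR 1) ^+ 3) C1 => c c1; apply: (lt_le_trans c1).
have c0 : 0 <= c by apply: le_trans (ltW c1).
by rewrite -!mulrA ler_peMr // !mulr_ege1.
Qed.

Let cond_pred : (8 * expR 1) ^+ 3 * M * r ^+ k.-1
  * (D%:R * k%:R + 1) `^ (2 + zeta q lambda) <= 1.
Proof.
have e m : (0 < m)%N -> r ^+ m.-1 = r ^ (m%:Z - 1).
  by case: m => // m _; rewrite /= -[m.+1]addn1 PoszD addrK.
by rewrite e ?cond_k_gt0.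
Qed.

Lemma cond_square : 512 * M * r ^+ k.-1 * ((D * k)%:R + 1) ^+ 2 <= 1.
Proof.
apply: le_trans cond_pred; have r0 := ltW (exprn_gt0 k.-1 r_max_gt0).
have M0 := le_trans ler01 M_ge1.
rewrite [(D * k)%:R]natrM; move: (512 : R) const_ge (ler0n R 512) => c cC c0.
apply: ler_pM => //; rewrite ?mulr_ge0 ?sqr_ge0 //.
by rewrite !ler_wpM2r.
Qed.

Lemma cond_square_bad : (r * (2 - r)) ^+ k.-1 * ((D * k)%:R + 1) ^+ 2 <= 1.
Proof.
rewrite [(D * k)%:R]natrM; apply: powR_zeta; rewrite ?r_max_gt0 ?r_max_lt1 //.
apply: le_trans cond_pred; rewrite ler_wpM2r ?powR_ge0 //.
rewrite ler_peMl ?exprn_ge0 ?(ltW r_max_gt0) // mulr_ege1 //.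
by apply: le_trans const_ge; rewrite ler1n.
Qed.

Lemma cond_Dk_gt1 : (1 < D * k)%N.
Proof.
have := cond_square; have := cond_k_gt0.
case: {-2}k (erefl k) => [//|[|m] km _ sq].
  exfalso; move: sq M_ge1 (ler0n R (D * 1)); rewrite expr0 mulr1.
  set a := M; set b := _%:R => sq a1 b0.
  have : 1 <= (b + 1) ^+ 2 by rewrite exprn_ege1 // lerDr.
  by nra.
by apply: leq_trans (leq_pmull _ D_gt0).
Qed.

Let nu : R := (D * k)%:R.
Let a : R := lambda / (q%:R - 1 + lambda).

Let a_gt0 : 0 < a. Proof. by rewrite divr_gt0 // q1 addr_gt0. Qed.

Let nu_ge2 : 2 <= nu. Proof. by rewrite ler_nat cond_Dk_gt1. Qed.

Let rkE : r ^+ k = a * (M * r ^+ k.-1).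
Proof. by rewrite -{1}(prednK cond_k_gt0) exprS {1}r_maxE mulrA. Qed.

Let rk_le : r ^+ k <= r ^+ k.-1.
Proof.
rewrite -{1}(prednK cond_k_gt0) exprS ler_piMl ?exprn_ge0 ?ltW ?r_max_gt0 //.
exact: r_max_lt1.
Qed.

Let rk_sq : 512 * r ^+ k * (nu + 1) ^+ 2 <= 1.
Proof.
move: (512 : R) (ler0n R 512) cond_square => c c0.
apply: le_trans; rewrite ler_wpM2r ?sqr_ge0 // -mulrA ler_wpM2l //.
by apply: le_trans rk_le _; rewrite ler_peMl ?exprn_ge0 ?(ltW r_max_gt0).
Qed.

Let rk_gt0 : 0 < r ^+ k. Proof. by rewrite exprn_gt0 // r_max_gt0. Qed.

Let rk_bounds :
  [/\ 4 * (nu * r ^+ k) * (nu + 1) <= 1, 8 * (nu * r ^+ k) <= 1 & 8 * r ^+ k <= 1].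
Proof.
move: (r ^+ k) rk_gt0 rk_sq => w w0 sq; have w0' := ltW w0.
have nu0 : 0 <= nu by move: nu_ge2; lra.
have h1 : 0 <= w * nu by rewrite mulr_ge0.
have h2 : 0 <= w * nu * nu by rewrite !mulr_ge0.
by split; lra.
Qed.

Lemma cond_x : 0 <= 2 * r ^+ k <= 1.
Proof. by case: rk_bounds => _ _; move: rk_gt0 => ? ?; apply/andP; split; lra. Qed.

Lemma cond_x_lt1 : 2 * r ^+ k < 1.
Proof. by case: rk_bounds => _ _; move: rk_gt0; lra. Qed.

Lemma cond_viol_small : r ^+ k <= 2 * r ^+ k * (1 - 2 * r ^+ k) ^+ (D * k).
Proof.
have := bernoulli_ler (D * k) cond_x; rewrite -/nu => H.
rewrite mulrAC ler_peMl ?(ltW rk_gt0) //.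
by case: rk_bounds => _ B _; move: H; move: (_ ^+ (D * k)) => Y H; lra.
Qed.

Lemma cond_bad_small : nu ^+ 2 * (r * (2 - r)) ^+ k <=
  nu / (nu + 1) * (1 - 2 * r ^+ k) ^+ (D * k + D * k).
Proof.
have nu1 : 0 < nu + 1 by move: nu_ge2; lra.
have nu0 : 0 <= nu by move: nu_ge2; lra.
have t0 : 0 <= nu / (nu + 1) by rewrite divr_ge0 // ltW.
apply: le_trans (_ : nu / (nu + 1) * (nu / (nu + 1)) <= _).
  have -> : nu / (nu + 1) * (nu / (nu + 1)) = nu ^+ 2 * (1 / (nu + 1) ^+ 2).
    by field; rewrite gt_eqF.
  rewrite ler_wpM2l ?sqr_ge0 // ler_pdivlMr ?exprn_gt0 //.
  apply: le_trans cond_square_bad; rewrite ler_wpM2r ?sqr_ge0 //.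
  have rr : 0 <= r * (2 - r) <= 1.
    by move: r_max_gt0 r_max_lt1; set y := r => *; apply/andP; split; nra.
  case/andP: rr => rr0 rr1.
  by rewrite -{1}(prednK cond_k_gt0) exprS ler_piMl ?exprn_ge0.
rewrite ler_wpM2l //; apply: le_trans (bernoulli_ler _ cond_x).
rewrite ler_pdivrMr // natrD -/nu.
by case: rk_bounds => B _ _; lra.
Qed.

Lemma cond_marginal : 0 < 1 - D%:R * (2 * r ^+ k) /\
  1 - a <= (1 - a * (1 - 1 / nu)) * (1 - D%:R * (2 * r ^+ k)).
Proof.
have Dnu : D%:R <= nu by rewrite ler_nat leq_pmulr // cond_k_gt0.
have D0 : 0 <= D%:R :> R by [].
split.
  have := ler_wpM2r (ltW rk_gt0) Dnu.
  by case: rk_bounds => _ B _; lra.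
rewrite rkE; set T := M * r ^+ k.-1; have nu2 := nu_ge2; have a0 := a_gt0.
have T0 : 0 <= T.
  by rewrite mulr_ge0 ?(le_trans ler01 M_ge1) // exprn_ge0 // ltW // r_max_gt0.
have sq : 512 * T * (nu + 1) ^+ 2 <= 1 by rewrite /T [512 * _]mulrA cond_square.
have nu0 : 0 < nu by lra.
have Ti : nu * (2 * T) <= 1 / nu.
  rewrite ler_pdivlMr //.
  have h1 : 0 <= T * nu by rewrite mulr_ge0 // ltW.
  have h2 : 0 <= T * nu * nu := mulr_ge0 h1 (ltW nu0).
  by lra.
have i0 : 0 <= 1 / nu by rewrite divr_ge0 // ltW.
have i1 : 1 / nu <= 1 by rewrite ler_pdivrMr //; lra.
move: (1 / nu) Ti i0 i1 => i Ti i0 i1.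
have DT : D%:R * (2 * T) <= i by apply: le_trans Ti; rewrite ler_wpM2r //; lra.
have a1 : a <= 1.
  by rewrite ler_pdivrMr q1 ?addr_gt0 // mul1r lerDr ltW.
have DT0 : 0 <= D%:R * (2 * T) by rewrite mulr_ge0 // mulr_ge0 // ler0n.
move: DT DT0; set e := D%:R * (2 * T) => DT DT0.
have -> : D%:R * (2 * (a * T)) = a * e by rewrite /e; ring.
have g1 : 0 <= a * (1 - i) by rewrite mulr_ge0 ?subr_ge0 // ltW.
have : a * e * (1 - a * (1 - i)) <= a * i.
  rewrite -mulrA ler_pM2l //; apply: le_trans DT; rewrite ler_piMr //; lra.
lra.
Qed.

End NumericBounds.

Lemma trivial_domain_tail (R : realType) (q : nat) (V C : finType)
    (Phi : csp_formula q V C) (lambda delta : R) :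
  (q <= 1)%N -> (0 < #|V|)%N -> 0 < lambda -> 0 < delta ->
  let mu := gibbs Phi lambda in
  let X := @num_ones R q V in
  Pr mu (fun sigma => `|X sigma - Ex mu X| >= delta * Ex mu X) = 0.
Proof.
move=> q1 V0 l0 d0 /=; apply: big1 => s tail.
rewrite {1}/gibbs; case: ifP => // sS; exfalso; move: tail.
rewrite leNgt => /negP; apply.
have one t : t = s.
  apply/ffunP => v; apply: val_inj => /=.
  have := leq_trans (ltn_ord (t v)) q1; have := leq_trans (ltn_ord (s v)) q1.
  by rewrite !ltnS !leqn0 => /eqP-> /eqP->.
have Xs : num_ones R s = #|V|%:R.
  rewrite /num_ones -sum1_card natr_sum; apply: eq_bigr => v _.
  have := leq_trans (ltn_ord (s v)) q1.
  by rewrite inE ltnS leqn0 => /eqP->.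
have E : Ex (gibbs Phi lambda) (@num_ones R q V) = #|V|%:R.
  rewrite /Ex (bigD1 s) //= big1 ?addr0 => [|t]; last by rewrite (one t) eqxx.
  rewrite /gibbs sS /partition_function (bigD1 s) //= big1 ?addr0 => [|t]; last first.
    by rewrite (one t) eqxx andbF.
  by rewrite divff ?mul1r ?Xs // expf_neq0 // gt_eqF.
by rewrite E Xs subrr normr0 mulr_gt0 // ltr0n.
Qed.

Section MainCase.
Import mathcomp.boot.fintype mathcomp.boot.finset.
Variables (R : realType) (n k D : nat) (V C : finType).
Local Notation q := n.+2.
Variables (Phi : csp_formula q V C) (lambda : R).
Hypothesis V_gt0 : (0 < #|V|)%N.
Hypothesis D_gt0 : (0 < D)%N.
Hypothesis atomicPhi : atomic Phi.
Hypothesis Phi_kD : kDelta_csp Phi k D.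
Hypothesis lambda_gt0 : 0 < lambda.
Hypothesis hcond : (8 * expR 1) ^+ 3 * Num.max 1 (1 / lambda)
  * r_max q lambda ^ (k%:Z - 1)
  * (D%:R * k%:R + 1) `^ (2 + zeta q lambda) <= 1.

Local Notation p := (@value_weight R n lambda).
Local Notation act := (has_violation Phi).
Local Notation bet := (violating_value Phi).
Local Notation vb := (vbl Phi).
Local Notation N := (D * k)%N.
Local Notation r := (r_max q lambda).
Local Notation x := (2 * r ^+ k).
Local Notation Z := (satw p vb act bet setT).
Local Notation mu := (gibbs Phi lambda).
Local Notation X := (@num_ones R q V).
Local Notation a := (lambda / (q%:R - 1 + lambda)).

Let p0 := @value_weight_ge0 R n lambda lambda_gt0.
Let p1 := @value_weight_sum1 R n lambda lambda_gt0.
Let card_vb : forall c, #|vb c| = k. Proof. by case: Phi_kD. Qed.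
Let deg_le : forall v, (#|[set c | v \in vb c]| <= D)%N.
Proof. by case: Phi_kD. Qed.
Let r0 : 0 <= r. Proof. exact: ltW (r_max_gt0 n lambda_gt0). Qed.
Let x0 : 0 <= x. Proof. by case/andP: (cond_x lambda_gt0 D_gt0 hcond). Qed.
Let x1 := cond_x_lt1 lambda_gt0 D_gt0 hcond.
Let viol_small := cond_viol_small lambda_gt0 D_gt0 hcond.
Let p_le := @value_weight_le R n lambda lambda_gt0.

Let viol_le := viol_prob p0 p1 act bet card_vb p_le.
Let touch_le := card_touch_vb card_vb deg_le.

Let Z_gt0 : 0 < Z.
Proof.
exact (satw_gt0 p0 p1 (act:=act) (bet:=bet) touch_le viol_le x0 x1 viol_small setT).
Qed.

Let muE s : mu s = weight p s * (sat vb act bet setT s)%:R / Z.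
Proof. exact: gibbs_weight. Qed.

Let mu_ge0 s : 0 <= mu s.
Proof. by rewrite muE divr_ge0 ?mulr_ge0 ?weight_ge0 ?(ltW Z_gt0). Qed.

Let mu_sum1 : \sum_s mu s = 1.
Proof.
by rewrite (eq_bigr _ (fun s _ => muE s)) -mulr_suml divff // gt_eqF.
Qed.

Lemma marginal_ge v :
  a * (1 - 1 / N%:R) <= \sum_s mu s * (v \in ones s)%:R.
Proof.
have [y0 ym] := cond_marginal lambda_gt0 D_gt0 hcond.
pose h (b : 'I_q) : R := (b != ord0)%:R.
have hE s : (v \in ones s)%:R = 1 - h (s v).
  by rewrite inE /h; case: (s v) => -[|m] mq; rewrite ?subr0 ?subrr.
have -> : \sum_s mu s * (v \in ones s)%:R = 1 - \sum_s mu s * h (s v).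
  rewrite -[1 in RHS]mu_sum1 -sumrB; apply: eq_bigr => s _.
  by rewrite hE mulrBr mulr1.
rewrite lerBrDr -lerBrDl; set e := \sum_s _.
have e0 : 0 <= e by apply: sumr_ge0 => s _; rewrite mulr_ge0.
have H : (1 - x) ^+ D * e <= 1 - a.
  have -> : 1 - a = expect p (fun s : {ffun V -> 'I_q} => h (s v)).
    rewrite (expect_coord h v p1); apply/eqP; rewrite subr_eq -[X in X == _]p1.
    have -> : a = p ord0 by rewrite /value_weight eqxx.
    rewrite !(big_ord_recl n.+1) /h eqxx mulr0 add0r addrC.
    by apply/eqP; congr (_ + _); apply: eq_bigr => b _; rewrite mulr1.
  have -> : e = expect p (fun s => h (s v) * (sat vb act bet setT s)%:R) / Z.
    rewrite /e /expect mulr_suml; apply: eq_bigr => s _; rewrite muE; ring.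
  rewrite mulrA ler_pdivrMr //.
  apply: (expect_sat_le p0 p1 touch_le viol_le x0 x1 viol_small (A := [set v])).
  - by move=> s; rewrite ler0n.
  - by move=> s t st; rewrite st // inE.
  by rewrite touch1.
rewrite -(ler_pM2r y0); apply: le_trans ym; apply: le_trans H.
rewrite mulrC ler_wpM2r //; apply: bernoulli_ler.
exact: cond_x lambda_gt0 D_gt0 hcond.
Qed.

Lemma mean_ge : #|V|%:R * (a * (1 - 1 / N%:R)) <= Ex mu X.
Proof.
have -> : Ex mu X = \sum_v \sum_s mu s * (v \in ones s)%:R.
  by rewrite exchange_big; apply: eq_bigr => s _; rewrite -mulr_sumr.
rewrite mulr_natl -sumr_const; apply: ler_sum => v _; exact: marginal_ge.
Qed.

Lemma pair_variance_le :
  \sum_s \sum_t mu s * mu t * (X s - X t) ^+ 2 <= #|V|%:R * (N%:R + 1).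
Proof.
have N1 : 0 < N%:R + 1 :> R by rewrite ltr_wpDl.
have N0 := ltnW (cond_Dk_gt1 lambda_gt0 D_gt0 hcond).
have t0 : 0 <= N%:R / (N%:R + 1) :> R by rewrite divr_ge0 // ltW.
have t1 : N%:R / (N%:R + 1) < 1 :> R by rewrite ltr_pdivrMr // mul1r ltrDl.
pose h (b : 'I_q) : R := (b.+1 == 1)%N%:R.
have h01 b : 0 <= h b <= 1 by rewrite /h; case: eqP; rewrite ler01 lexx.
have := pair_sat_variance p0 p1 act bet card_vb deg_le N0 p_le
  (ltW (r_max_lt1 n lambda_gt0)) r0 x0 x1 viol_small t0 t1
  (cond_bad_small lambda_gt0 D_gt0 hcond) h01.
have -> : (1 - N%:R / (N%:R + 1))^-1 = N%:R + 1 :> R.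
  by field; rewrite gt_eqF //= addrC addKr oner_eq0.
rewrite mulrA -ler_pdivrMr ?mulr_gt0 //; apply: le_trans.
rewrite le_eqVlt; apply/orP; left; apply/eqP.
rewrite /pair_sat mulr_suml; apply: eq_bigr => s _.
rewrite mulr_suml; apply: eq_bigr => t _; rewrite !muE.
have XE u : X u = \sum_v h (u v) by apply: eq_bigr => v _; rewrite inE.
by rewrite !XE; field; rewrite gt_eqF.
Qed.

Lemma tail_bound (delta : R) : 0 < delta ->
  Pr mu (fun sigma => `|X sigma - Ex mu X| >= delta * Ex mu X)
  <= 4 * D%:R * k%:R * (D%:R * k%:R + 1)
     / (delta ^+ 2 * (a * (1 - 1 / (D%:R * k%:R))) ^+ 2 * #|V|%:R).
Proof.
move=> d0; rewrite -[4 * _ * k%:R]mulrA -![D%:R * k%:R]natrM.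
set P := Pr _ _; have N2 := cond_Dk_gt1 lambda_gt0 D_gt0 hcond.
have Nr : 2 <= N%:R :> R by rewrite ler_nat.
have M := mean_ge; have Vr : 0 < #|V|%:R :> R by rewrite ltr0n.
set b := a * (1 - 1 / N%:R) in M *.
have b0 : 0 < b.
  have W0 : 0 < q%:R - 1 + lambda by rewrite -[q%:R]natr1 addrK ltr_wpDl.
  rewrite mulr_gt0 ?divr_gt0 // subr_gt0 ltr_pdivrMr; lra.
have m0 : 0 <= Ex mu X by apply: le_trans M; rewrite mulr_ge0 ?ltW.
have P0 : 0 <= P by apply: sumr_ge0.
have := le_trans (chebyshev_pair X mu_ge0 mu_sum1 (mulr_ge0 (ltW d0) m0))
  pair_variance_le.
rewrite -/P => H.
have Vb : 0 <= #|V|%:R * b by rewrite mulr_ge0 ?ltW.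
have sq : (delta * (#|V|%:R * b)) ^+ 2 <= (delta * Ex mu X) ^+ 2.
  apply: lerXn2r; last by rewrite ler_pM2l.
    by rewrite nnegrE mulr_ge0 // ltW.
  by rewrite nnegrE mulr_ge0 // ltW.
have {H} H : #|V|%:R * (2 * (P * (delta ^+ 2 * b ^+ 2 * #|V|%:R))) <=
    #|V|%:R * (N%:R + 1).
  apply: le_trans H; apply: le_trans (_ : 2 * (P * (delta * (#|V|%:R * b)) ^+ 2) <= _).
    by rewrite le_eqVlt; apply/orP; left; apply/eqP; ring.
  by rewrite ler_wpM2l // ler_wpM2l.
rewrite ler_pM2l // in H.
rewrite ler_pdivlMr; last by rewrite -/b mulr_gt0 // mulr_gt0 // exprn_gt0.
move: (P * _) H Nr; move: (N%:R : R) => nu L H Nr; nra.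
Qed.

End MainCase.

Theorem theoremB2 (R : realType) (q k Delta : nat) (V C : finType)
  (Phi : csp_formula q V C) (lambda : R)
  (hV : (0 < #|V|)%N) (hDelta : (0 < Delta)%N)
  (hatomic : atomic Phi) (hkDelta : kDelta_csp Phi k Delta)
  (hlambda : 0 < lambda)
  (hcond : (8 * expR 1) ^+ 3 * Num.max 1 (1 / lambda)
             * r_max q lambda ^ (k%:Z - 1)
             * (Delta%:R * k%:R + 1) `^ (2 + zeta q lambda) <= 1)
  (delta : R) (hdelta : 0 < delta) :
  let mu := gibbs Phi lambda in
  let X := @num_ones R q V in
  Pr mu (fun sigma => `|X sigma - Ex mu X| >= delta * Ex mu X)
  <= 4 * Delta%:R * k%:R * (Delta%:R * k%:R + 1)
     / (delta ^+ 2
        * (lambda / (q%:R - 1 + lambda) * (1 - 1 / (Delta%:R * k%:R))) ^+ 2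
        * #|V|%:R).
Proof.
have [q1|] := leqP q 1.
  rewrite /= trivial_domain_tail //.
  apply: divr_ge0; last by rewrite mulr_ge0 // mulr_ge0 // sqr_ge0.
  by rewrite mulr_ge0 ?addr_ge0 ?mulr_ge0.
by case: q Phi hatomic hkDelta hcond => [|[|n]] // *; exact: tail_bound.
Qed.
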